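(* Let $K$ be a perfect field of prime characteristic $p>0$, let $A=K[\theta_1,\theta_2,\ldots,\theta_n,\ldots]$ be the polynomial ring in countably infinitely many indeterminates, let $\mathfrak{p}_i=(\theta_i)$ for $i\in\mathbb{N}=\{1,2,\ldots\}$, let $S=A\setminus\bigcup_{i\in\mathbb{N}}\mathfrak{p}_i$, and let $R=S^{-1}A$. Then $R$ is a Noetherian ring of dimension $1$, and the $R$-module $R$ has an $x$-divisible right $R[x,f]$-module structure (extending its natural $R$-module structure) such that $S^{-1}\mathfrak{p}_i\in\mathcal{I}^s(R)$ for every $i\in\mathbb{N}$. In particular $\mathcal{I}^s(R)$ is infinite, so that the set of graded annihilators of $R[x,f]$-homomorphic images of this $x$-divisible right $R[x,f]$-module $R$, which is Noetherian as an $R$-module, is infinite.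
   Context: For a commutative ring $R$ of prime characteristic $p$, $f:R\to R$, $f(r)=r^p$, is the Frobenius endomorphism. The Frobenius skew polynomial ring $R[x,f]$ is the free left $R$-module with basis $(x^i)_{i\in\mathbb{N}_0}$, with multiplication determined by $xr=f(r)x=r^px$ for $r\in R$; it is graded, $R[x,f]=\bigoplus_{n\in\mathbb{N}_0}Rx^n$. A right $R[x,f]$-module is viewed as an $R$-module by restriction to $R=Rx^0$. For a right $R[x,f]$-module $H$, the graded annihilator $\text{gr-ann}(H)_{R[x,f]}$ is the largest graded two-sided ideal of $R[x,f]$ annihilating $H$; explicitly it is the set of all finite sums $\sum_{i=0}^n r_ix^i$ ($r_i\in R$) such that $H(r_ix^i)=0$ for every $i$. $H$ is $x$-divisible if $H=Hx$. For an $x$-divisible right $R[x,f]$-module $M$, an ideal $\mathfrak{b}$ of $R$ is a special $M$-ideal if there is an $R[x,f]$-submodule $N$ of $M$ with $\bigoplus_{n\in\mathbb{N}_0}\mathfrak{b}x^n=\text{gr-ann}(M/N)_{R[x,f]}$. $\mathcal{I}(M)$ is the set of special $M$-ideals and $\mathcal{I}^s(M)=\mathcal{I}(M)\cap\operatorname{Spec}(R)$. *)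

(* Defs.v *)
From HB Require Import structures.
From mathcomp Require Import all_boot all_order all_algebra.
From mathcomp Require Import boolp classical_sets functions cardinality.
From mathcomp Require Import generic_quotient ring_quotient.
From mathcomp Require Import monalg.

Set Implicit Arguments.
Unset Strict Implicit.
Unset Printing Implicit Defensive.

Import GRing.Theory.

Local Open Scope classical_set_scope.
Local Open Scope ring_scope.

Definition is_ideal (R : comNzRingType) (I : set R) : Prop :=
  I 0 /\ forall a u v, I u -> I v -> I (a * u + v).

Definition Spec (R : comNzRingType) : set (set R) :=
  [set P | [/\ is_ideal P, ~ P 1 & forall a b, P (a * b) -> P a \/ P b]].

Definition principal_ideal (R : comNzRingType) (a : R) : set R :=
  [set r | exists b, r = b * a].

Definition prime_chain (R : comNzRingType) (n : nat) (P : nat -> set R) : Prop :=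
  (forall i, (i <= n)%N -> Spec (P i)) /\
  (forall i, (i < n)%N -> P i `<` P i.+1).

Definition has_krull_dim (R : comNzRingType) (d : nat) : Prop :=
  (exists P, @prime_chain R d P) /\ ~ (exists P, @prime_chain R d.+1 P).

Definition noetherian_module (R : nzRingType) (V : lmodType R) : Prop :=
  forall N : nat -> submodClosed V,
    (forall i, {subset N i <= N i.+1}) ->
    exists k, forall i, (k <= i)%N -> N i =i N k.

Definition noetherian_ring (R : comNzRingType) : Prop := @noetherian_module R R^o.

Definition perfect_field (K : fieldType) (p : nat) : Prop :=
  forall a : K, exists b : K, b ^+ p = a.

(* [S^-1 A], characterised up to unique isomorphism as an [A]-algebra. *)
Record is_localization (A R : comNzRingType) (S : set A)
    (phi : {rmorphism A -> R}) : Prop := IsLocalization {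
  loc_unit : forall s, S s -> exists t, phi s * t = 1;
  loc_frac : forall r, exists a s, S s /\ r * phi s = phi a;
  loc_eq : forall a b, phi a = phi b <-> exists s, S s /\ s * a = s * b
}.

(* The ideal [S^-1 I], i.e. the fractions [phi a / phi s] with [a] in [I]. *)
Definition loc_ideal (A R : comNzRingType) (S : set A)
    (phi : {rmorphism A -> R}) (I : set A) : set R :=
  [set r | exists a s, [/\ I a, S s & r * phi s = phi a]].

(* The monoid algebra of the free commutative monoid on [nat], i.e. the
   polynomial ring in the indeterminates [theta 0], [theta 1], ... *)
Definition polyInf (K : fieldType) : comNzRingType := {malg K[{cmonom nat}]}.

Definition theta (K : fieldType) (i : nat) : polyInf K := mkmalgU (ucm i) 1.

Definition theta_compl (K : fieldType) : set (polyInf K) :=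
  [set s | forall i, ~ principal_ideal (theta K i) s].

Lemma pchar_polyInf_rmorph (K : fieldType) (R : comNzRingType) (p : nat)
    (phi : {rmorphism polyInf K -> R}) : p \in [pchar K] -> p \in [pchar R].
Proof.
move=> charK; apply: (rmorph_pchar phi).
exact: (rmorph_pchar (malgC : {rmorphism K -> {malg K[{cmonom nat}]}})).
Qed.

(* The underlying left module of [R[x,f]] is that of [{poly R}], with ['X^i]
   standing for [x^i]; only the product is twisted. *)
Definition frobSkew (R : comNzRingType) (p : nat) (charRp : p \in [pchar R])
  : Type := {poly R}.

Section FrobSkew.
Variables (R : comNzRingType) (p : nat) (charRp : p \in [pchar R]).

Local Notation sk := (frobSkew charRp).
Implicit Types u v w : {poly R}.

HB.instance Definition _ := GRing.Lmodule.copy sk {poly R}.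

(* (a x^i) (b x^j) = (a b^(p^i)) x^(i+j) *)
Definition skew_mul u v : {poly R} :=
  \poly_(k < (size u + size v).-1) \sum_(i < k.+1) u`_i * v`_(k - i) ^+ (p ^ i).

Lemma skew_pgt0 i : (0 < p ^ i)%N.
Proof. by rewrite expn_gt0 prime_gt0 // (pcharf_prime charRp). Qed.

Lemma skew_exp0 i : (0 : R) ^+ (p ^ i) = 0.
Proof. by rewrite expr0n -[_ == _]negbK -lt0n skew_pgt0. Qed.

Lemma skew_expD i (a b : R) : (a + b) ^+ (p ^ i) = a ^+ (p ^ i) + b ^+ (p ^ i).
Proof.
apply: exprDn_pchar; rewrite pnatX; apply/orP; left.
by rewrite pnatE ?(pcharf_prime charRp).
Qed.

Lemma coef_skew_mul u v k :
  (skew_mul u v)`_k = \sum_(i < k.+1) u`_i * v`_(k - i) ^+ (p ^ i).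
Proof.
rewrite coef_poly ltn_predRL; case: leqP => // le_uv_k1.
rewrite big1 // => j _; have [lu_j|lt_j_u] := leqP (size u) j.
  by rewrite nth_default ?mul0r.
rewrite [v`__]nth_default ?skew_exp0 ?mulr0 // leq_subRL -ltnS //.
by rewrite (leq_trans _ le_uv_k1) // ltn_add2r.
Qed.

Lemma coef_skew_mul_rev u v k :
  (skew_mul u v)`_k = \sum_(i < k.+1) u`_(k - i) * v`_i ^+ (p ^ (k - i)).
Proof.
rewrite coef_skew_mul (reindex_inj rev_ord_inj) /=.
by apply: eq_bigr => j _; rewrite (sub_ordK j).
Qed.

Lemma skew_mulA : associative skew_mul.
Proof.
move=> u v w; apply/polyP=> i; rewrite coef_skew_mul coef_skew_mul_rev.
pose coef3 j k :=
  u`_j * (v`_(i - j - k) ^+ (p ^ j) * w`_k ^+ (p ^ (i - k))).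
transitivity (\sum_(j < i.+1) \sum_(k < i.+1 | (k <= i - j)%N) coef3 j k).
  apply: eq_bigr => /= j _; rewrite coef_skew_mul_rev.
  rewrite (big_morph _ (@skew_expD j) (skew_exp0 j)) big_distrr /=.
  rewrite (big_ord_narrow_leq (leq_subr _ _)); apply: eq_bigr => k _ /=.
  rewrite /coef3 exprMn -exprM -expnD; congr (_ * (_ * _ ^+ (p ^ _))).
  by rewrite addnC addnBA ?leq_ord // subnKC ?leq_ord.
rewrite (exchange_big_dep predT) //=; apply: eq_bigr => k _.
transitivity (\sum_(j < i.+1 | (j <= i - k)%N) coef3 j k).
  apply: eq_bigl => j; rewrite -ltnS -(ltnS j) -!subSn ?leq_ord //.
  by rewrite -subn_gt0 -(subn_gt0 j) -!subnDA addnC.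
rewrite (big_ord_narrow_leq (leq_subr _ _)) coef_skew_mul big_distrl /=.
by apply: eq_bigr => j _; rewrite /coef3 -!subnDA addnC mulrA.
Qed.

Lemma skew_mul1 : right_id 1%:P skew_mul.
Proof.
move=> u; apply/polyP => i; rewrite coef_skew_mul_rev big_ord_recl subn0.
rewrite coefC eqxx expr1n mulr1 big1 ?addr0 // => j _.
by rewrite coefC /= skew_exp0 mulr0.
Qed.

Lemma skew_1mul : left_id 1%:P skew_mul.
Proof.
move=> u; apply/polyP => i; rewrite coef_skew_mul big_ord_recl subn0.
rewrite coefC eqxx mul1r expr1 big1 ?addr0 // => j _.
by rewrite coefC /= mul0r.
Qed.

Lemma skew_mulDl : left_distributive skew_mul +%R.
Proof.
move=> u v w; apply/polyP=> i; rewrite coefD !coef_skew_mul -big_split.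
by apply: eq_bigr => j _; rewrite coefD mulrDl.
Qed.

Lemma skew_mulDr : right_distributive skew_mul +%R.
Proof.
move=> u v w; apply/polyP=> i; rewrite coefD !coef_skew_mul -big_split.
by apply: eq_bigr => j _; rewrite coefD skew_expD mulrDr.
Qed.

HB.instance Definition _ := GRing.Zmodule_isNzRing.Build sk
  skew_mulA skew_1mul skew_mul1 skew_mulDl skew_mulDr (oner_neq0 {poly R}).

(* r x^i *)
Definition skewM (r : R) (i : nat) : sk := r *: 'X^i.

Lemma skewMM (a b : R) i j :
  skewM a i * skewM b j = skewM (a * b ^+ (p ^ i)) (i + j).
Proof.
apply/polyP=> k; rewrite [LHS]coef_skew_mul coefZ coefXn.
have [le_ik|lt_ki] := leqP i k; last first.
  rewrite big1 => [|l _]; last first.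
    rewrite coefZ coefXn ltn_eqF ?mulr0 ?mul0r //.
    by rewrite (leq_trans _ lt_ki) // ltn_ord.
  by rewrite ltn_eqF ?mulr0 // ltn_addr.
rewrite (bigD1 (Ordinal (le_ik : (i < k.+1)%N))) //= big1 => [|l ne_l]; last first.
  rewrite coefZ coefXn (_ : (l == i :> nat) = false) ?mulr0 ?mul0r //.
  by apply: contraNF ne_l => /eqP eq_li; apply/eqP/val_inj.
rewrite !coefZ !coefXn eqxx mulr1 addr0 -(eqn_add2l i (k - i)) subnKC //.
by case: eqP; rewrite ?mulr1 // !mulr0 skew_exp0 mulr0.
Qed.

End FrobSkew.

(* Right [R[x,f]]-modules are left modules over the opposite ring. *)
Notation rightModType charRp := (lmodType (frobSkew charRp)^c).

Definition ract (R : comNzRingType) (p : nat) (charRp : p \in [pchar R])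
    (M : rightModType charRp) (m : M) (u : frobSkew charRp) : M :=
  (u : (frobSkew charRp)^c) *: m.

Section RightModules.
Variables (R : comNzRingType) (p : nat) (charRp : p \in [pchar R]).
Local Notation sk := (frobSkew charRp).
Implicit Types (M H : rightModType charRp).

Lemma ractM M (m : M) (u v : sk) : ract m (u * v) = ract (ract m u) v.
Proof. by rewrite /ract scalerA. Qed.

Definition restr_scal M : Type := M.
HB.instance Definition _ M := GRing.Zmodule.copy (restr_scal M) M.

Definition restr_scal_act M (r : R) (m : restr_scal M) : restr_scal M :=
  ract (m : M) (skewM charRp r 0).

Fact restr_scal_actA M (a b : R) (m : restr_scal M) :
  restr_scal_act a (restr_scal_act b m) = restr_scal_act (a * b) m.
Proof.
by rewrite /restr_scal_act -ractM skewMM expn0 expr1 mulrC addn0.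
Qed.

Fact restr_scal_act1 M : left_id 1 (@restr_scal_act M).
Proof. by move=> m; rewrite /restr_scal_act /skewM scale1r; apply: scale1r. Qed.

Fact restr_scal_actDr M : right_distributive (@restr_scal_act M) +%R.
Proof. by move=> r m n; apply: scalerDr. Qed.

Fact restr_scal_actDl M (m : restr_scal M) :
  {morph (@restr_scal_act M)^~ m : a b / a + b}.
Proof.
by move=> a b; rewrite /restr_scal_act /skewM scalerDl; apply: scalerDl.
Qed.

HB.instance Definition _ M := GRing.Zmodule_isLmodule.Build R (restr_scal M)
  (@restr_scal_actA M) (@restr_scal_act1 M) (@restr_scal_actDr M)
  (@restr_scal_actDl M).

Definition x_divisible M : Prop :=
  forall m : M, exists m' : M, m = ract m' (skewM charRp 1 1).

(* [frobSkew charRp] being [{poly R}], u`_i is the coefficient of x^i. *)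
Definition gr_ann H : set sk :=
  [set u | forall (i : nat) (h : H),
     ract h (skewM charRp (u : {poly R})`_i i) = 0].

Definition graded_extension (b : set R) : set sk :=
  [set u | forall i : nat, b (u : {poly R})`_i].

Section QuotientModule.
Variables (M : rightModType charRp) (N : submodClosed M).

Definition submod_zmod : zmodClosed M :=
  HB.pack (GRing.SubmodClosed.sort N) (GRing.isOppClosed.Build M
    (GRing.SubmodClosed.sort N)
    (GRing.zmod_closedN (GRing.submod_closedB (submodClosedP N)))).

Definition quotmod : Type := {ideal_quot submod_zmod}.
HB.instance Definition _ := GRing.Zmodule.copy quotmod {ideal_quot submod_zmod}.

Definition quot_proj (m : M) : quotmod := \pi_({ideal_quot submod_zmod})%qT m.

Definition quotmod_scale (a : sk^c) (q : quotmod) : quotmod :=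
  quot_proj (a *: repr (q : {ideal_quot submod_zmod})).

Lemma quot_projE (m n : M) : (quot_proj m == quot_proj n) = (m - n \in N).
Proof. by rewrite -[RHS]/(m - n \in submod_zmod) Quotient.idealrBE. Qed.

Lemma quot_reprK (q : quotmod) : quot_proj (repr (q : {ideal_quot submod_zmod})) = q.
Proof. exact: reprK. Qed.

Lemma quot_projD : {morph quot_proj : m n / m + n}.
Proof. exact: Quotient.pi_add. Qed.

Lemma quotmod_scaleE a m : quotmod_scale a (quot_proj m) = quot_proj (a *: m).
Proof.
apply/eqP; rewrite quot_projE -scalerBr rpredZ // -quot_projE quot_reprK.
exact: eqxx.
Qed.

Fact quotmod_scaleA a b q :
  quotmod_scale a (quotmod_scale b q) = quotmod_scale (a * b) q.
Proof. by rewrite -[q]quot_reprK !quotmod_scaleE scalerA. Qed.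

Fact quotmod_scale1 : left_id 1 quotmod_scale.
Proof. by move=> q; rewrite -[q]quot_reprK quotmod_scaleE scale1r. Qed.

Fact quotmod_scaleDr : right_distributive quotmod_scale +%R.
Proof.
move=> a q r; rewrite -[q]quot_reprK -[r]quot_reprK -quot_projD.
by rewrite !quotmod_scaleE scalerDr quot_projD.
Qed.

Fact quotmod_scaleDl q : {morph quotmod_scale^~ q : a b / a + b}.
Proof.
by move=> a b; rewrite -[q]quot_reprK !quotmod_scaleE scalerDl quot_projD.
Qed.

HB.instance Definition _ := GRing.Zmodule_isLmodule.Build sk^c quotmod
  quotmod_scaleA quotmod_scale1 quotmod_scaleDr quotmod_scaleDl.

End QuotientModule.

Definition special_ideals M : set (set R) :=
  [set b | is_ideal b /\
     exists N : submodClosed M, graded_extension b = gr_ann (quotmod N)].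

Definition special_prime_ideals M : set (set R) := special_ideals M `&` @Spec R.

Definition gr_ann_images M : set (set sk) :=
  [set J | exists (H : rightModType charRp) (h : {linear M -> H}),
     (forall y, exists m, h m = y) /\ J = gr_ann H].

(* Right R[x,f]-module structures on the additive group of R. *)
Definition right_structure : Type := GRing.Zmodule_isLmodule sk^c R.

Definition right_module_of (str : GRing.Zmodule_isLmodule sk^c R) :
    rightModType charRp :=
  HB.pack (GRing.ComNzRing.sort R) str.

Definition extends_regular (str : right_structure) : Prop :=
  forall r m : R, ract (m : right_module_of str) (skewM charRp r 0) = m * r.

End RightModules.

(* Main.v *)
Require Import Defs.
From HB Require Import structures.
From mathcomp Require Import all_boot all_order all_algebra.
From mathcomp Require Import boolp classical_sets functions cardinality.
From mathcomp Require Import zify ring finmap monalg.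

Set Implicit Arguments.
Unset Strict Implicit.
Unset Printing Implicit Defensive.

Import GRing.Theory.

Local Open Scope classical_set_scope.
Local Open Scope ring_scope.

(** A right R[x,f]-structure on R extending the regular one is the same thing
    as an additive map C (the action of x) with C (c^p m) = c C m.  On the
    polynomial ring A the standard Frobenius splitting is such a map: it drops
    the monomials whose exponents are not all divisible by p and extracts the
    p-th root of the rest, which is possible because K is perfect.  It fixes 1
    and sends each (theta_i) into itself, and both properties survive the
    extension to R ([cartier_map]).

    Since C 1 = 1, one has C (m^p) = m, so the module is x-divisible.  Since
    C preserves P_i = (theta_i) R, P_i is an R[x,f]-submodule.  The coefficient
    r of an annihilator r x^n of R / P_i satisfies C^n (m r) in P_i for all m;
    if r were outside the maximal ideal P_i, then m could be chosen with m r in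
    1 + P_i, and C^n (m r) would lie in 1 + P_i, a contradiction.  So the graded
    annihilator of R / P_i is the extension of P_i ([gr_ann_stable]), and
    distinct i give distinct annihilators.

    The ring theory of R rests on one computation: for i <> j the sum
    theta_i + theta_j lies in none of the (theta_k), so it becomes a unit, and
    theta_i, theta_j are comaximal in R.  As every nonzero element of R is a
    unit times a product of theta's ([theta_factor]), a nonzero ideal is generated
    by any product of theta's of least length that it contains
    ([ideal_principal]).  This gives the ascending chain condition and
    dimension 1.

    That A is a domain and that theta_i is prime both come from the fact that
    two nonempty finite sets of monomials have a product attained only once
    ([unique_product]). *)

(** * Monomials and primes of the polynomial ring *)

(** Keep in each set only the monomials of largest exponent in a variable that
    separates two elements of X or of Y: a product of two survivors is not a
    product of other elements, and the sets shrink until both are singletons. *)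
Lemma unique_product (X Y : seq {cmonom nat}) :
  X != [::] -> Y != [::] ->
  exists m n : {cmonom nat}, [/\ m \in X, n \in Y &
    {in X & Y, forall k l, mmul k l = mmul m n -> k = m /\ l = n}].
Proof.
have [d] := ubnP (size X + size Y); elim: d X Y => // d IHd X Y ltd X0 Y0.
pose mx i (Z : seq {cmonom nat}) : nat := (\max_(l <- Z) (l : {cmonom nat}) i)%N.
pose top i (Z : seq {cmonom nat}) : seq {cmonom nat} :=
  [seq k : {cmonom nat} <- Z | k i == mx i Z].
have le_max i (Z : seq {cmonom nat}) k : k \in Z -> (k i <= mx i Z)%N.
  by move=> Zk; rewrite /mx (big_rem k Zk) /= leq_maxl.
have top_neq0 i Z : Z != [::] -> top i Z != [::].
  move=> Z0; suff [k Zk /eqP kE] : exists2 k, k \in Z & k i = (mx i Z)%N.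
    by apply/negP => /eqP top0; move: (in_nil k); rewrite -top0 mem_filter kE Zk.
  elim: Z Z0 => // k [_ _|l Z IHZ _].
    by exists k; rewrite ?mem_head// /mx big_seq1.
  have [h Zh hE] := IHZ isT; rewrite /mx big_cons -/(mx i (l :: Z)) -hE.
  case: (leqP (h i) (k i)); first by exists k; rewrite ?mem_head.
  by exists h; rewrite // in_cons Zh orbT.
have size_top i Z : (size (top i Z) <= size Z)%N.
  by rewrite size_filter count_size.
have size_top_lt i (Z : seq {cmonom nat}) (k l : {cmonom nat}) :
    k \in Z -> l \in Z -> k i != l i ->
    (size (top i Z) < size Z)%N.
  move=> Zk Zl kl; rewrite ltn_neqAle size_top andbT size_filter -all_count.
  by apply: contra kl => /allP Ztop; rewrite (eqP (Ztop _ Zk)) (eqP (Ztop _ Zl)).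
(* A product whose exponent in the variable i is the largest possible has both
   factors of largest exponent, hence among the survivors. *)
have step i : (size (top i X) + size (top i Y) < size X + size Y)%N ->
    exists m n : {cmonom nat}, [/\ m \in X, n \in Y &
      {in X & Y, forall k l, mmul k l = mmul m n -> k = m /\ l = n}].
  move=> lt_top; have [m [n []]] :=
    IHd _ _ (leq_trans lt_top ltd) (top_neq0 i _ X0) (top_neq0 i _ Y0).
  rewrite !mem_filter => /andP[/eqP mi Xm] /andP[/eqP ni Yn] mnP.
  exists m, n; split=> // k l Xk Yl kl.
  have /eqP := congr1 (fun h : {cmonom nat} => h i) kl.
  rewrite /= !cmM => /eqP kli.
  have lek := le_max i _ _ Xk; have lel := le_max i _ _ Yl.
  have [ki li] : k i = m i /\ l i = n i by split; lia.
  by apply: mnP; rewrite // mem_filter ?ki ?li ?mi ?ni eqxx.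
have sep (Z : seq {cmonom nat}) (m : {cmonom nat}) : m \in Z ->
    (forall k, k \in Z -> k = m) \/ exists i, (size (top i Z) < size Z)%N.
  move=> Zm; have [allm|/existsNP[k /not_implyP[Zk km]]] :=
    pselect (forall k, k \in Z -> k = m).
    by left.
  right; have /existsNP[i /eqP kmi] : ~ forall i, k i = m i.
    by move=> /cmP /eqP.
  by exists i; apply: size_top_lt Zk Zm kmi.
have pick (Z : seq {cmonom nat}) : Z != [::] -> exists m : {cmonom nat}, m \in Z.
  by case: Z => // m Z _; exists m; rewrite mem_head.
have [[m Xm] [n Yn]] := (pick X X0, pick Y Y0).
have [allX|[i lti]] := sep X m Xm; last by apply: (step i); rewrite -addSn leq_add.
have [allY|[i lti]] := sep Y n Yn; last by apply: (step i); rewrite -addnS leq_add.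
by exists m, n; split=> // k l Xk Yl _; rewrite (allX k Xk) (allY l Yl).
Qed.

Local Notation mono := {cmonom nat}.

(** These operations are locked because conversion would otherwise unfold the
    finitely supported functions underlying the monoid algebra when it compares
    two different polynomials. *)
HB.lock Definition term (K : fieldType) (c : K) (m : mono) : polyInf K := << c *g m >>.
HB.lock Definition coefm (K : fieldType) (a : polyInf K) (m : mono) : K := a@_m.
HB.lock Definition supp (K : fieldType) (a : polyInf K) : seq mono := msupp a.
HB.lock Definition restr (K : fieldType) (P : pred mono) (a : polyInf K) : polyInf K :=
  [malg m in msupp a => if P m then a@_m else 0].

Section Coefficients.
Variable K : fieldType.
Local Notation A := (polyInf K).
Implicit Types (a b : A) (m k : mono) (c d : K).

Lemma coefmP a b : (forall m, coefm a m = coefm b m) -> a = b.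
Proof. by rewrite coefm.unlock => ab; apply/malgP. Qed.

Lemma coefm0 m : coefm (0 : A) m = 0.
Proof. by rewrite coefm.unlock mcoeff0. Qed.

Lemma coefmD a b m : coefm (a + b) m = coefm a m + coefm b m.
Proof. by rewrite coefm.unlock mcoeffD. Qed.

Lemma coefm_term c m k : coefm (term c m) k = if m == k then c else 0.
Proof. by rewrite coefm.unlock term.unlock mcoeffU; case: eqP. Qed.

Lemma mem_supp a m : (m \in supp a) = (coefm a m != 0).
Proof. by rewrite coefm.unlock supp.unlock mcoeff_neq0. Qed.

Lemma supp_uniq a : uniq (supp a).
Proof. by rewrite supp.unlock fset_uniq. Qed.

Lemma supp_sum a : a = \sum_(m <- supp a) term (coefm a m) m.
Proof. by rewrite coefm.unlock supp.unlock term.unlock; apply: monalgE. Qed.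

Lemma termM c d m k : term c m * term d k = term (c * d) (mmul m k).
Proof. by rewrite term.unlock malgM_def fgmulUU. Qed.

Lemma coefmM a b h : coefm (a * b) h =
  \sum_(m <- supp a) \sum_(k <- supp b) (coefm a m * coefm b k) *+ (mmul m k == h).
Proof. by rewrite coefm.unlock supp.unlock mcoeffMl. Qed.

Lemma theta_term i : theta K i = term 1 (ucm i).
Proof. by rewrite term.unlock. Qed.

Lemma one_term : 1 = term 1 mone :> A.
Proof. by rewrite term.unlock. Qed.

Lemma coefm_restr P a m : coefm (restr P a) m = if P m then coefm a m else 0.
Proof.
by rewrite coefm.unlock restr.unlock mcoeffE; case: msuppP => //; case: ifP.
Qed.

End Coefficients.

Section PolyInf.
Variable K : fieldType.
Local Notation A := (polyInf K).
Implicit Types (a b : A) (m k : mono) (c d : K).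

Lemma polyInf_ind (Q : A -> Prop) :
  Q 0 -> (forall a b, Q a -> Q b -> Q (a + b)) ->
  (forall c m, Q (term c m)) -> forall a, Q a.
Proof.
move=> Q0 QD Qm a; rewrite [a]supp_sum.
by elim/big_ind: _ => // m _; apply: Qm.
Qed.

Lemma supp_neq0 a : a != 0 -> exists m, m \in supp a.
Proof.
move=> a0; case: (supp a) (supp_sum a) => [aE|m s _].
  by rewrite aE big_nil eqxx in a0.
by exists m; rewrite mem_head.
Qed.

Lemma polyInf_domain a b : a * b = 0 -> a = 0 \/ b = 0.
Proof.
have [->|a0] := eqVneq a 0; first by left.
have [->|b0] := eqVneq b 0; first by right.
move=> ab0; exfalso.
have supp0 (e : A) : e != 0 -> supp e != [::].
  by move=> /supp_neq0[m]; apply: contraTneq => ->.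
have [m [n [am bn mnP]]] := unique_product (supp0 a a0) (supp0 b b0).
have := coefm0 K (mmul m n); rewrite -ab0 coefmM.
rewrite (bigD1_seq m) ?supp_uniq //= [X in _ + X]big1_seq => [|k /andP[km ak]].
  rewrite addr0 (bigD1_seq n) ?supp_uniq //= [X in _ + X]big1_seq => [|l /andP[ln bl]].
    move/eqP; rewrite addr0 eqxx mulr1n mulf_eq0 -[_ || _]negbK.
    by rewrite negb_or -!mem_supp am bn.
  case: eqP => // /mnP[//|//|_ lE]; by rewrite lE eqxx in ln.
rewrite big1_seq => // l /andP[_ bl].
case: eqP => // /mnP[//|//|kE]; by rewrite kE eqxx in km.
Qed.

(** Restricting to the monomials in a set P serves twice: with P the monomials
    free of theta_i it is reduction modulo theta_i, and with P the p-th powers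
    it is the first half of the Frobenius splitting. *)
Section Restriction.
Variable P : pred mono.

Lemma restrD : {morph @restr K P : a b / a + b}.
Proof.
move=> a b; apply: coefmP => m; rewrite coefmD !coefm_restr coefmD.
by case: ifP; rewrite ?addr0.
Qed.

Lemma restr0 : restr P (0 : A) = 0.
Proof. by apply: coefmP => m; rewrite coefm_restr coefm0; case: ifP. Qed.

Lemma restr_term c m : restr P (term c m) = if P m then term c m else 0.
Proof.
apply: coefmP => k; rewrite coefm_restr coefm_term; have [<-|nmk] := eqVneq m k.
  by case: ifP; rewrite ?coefm0 ?coefm_term ?eqxx.
by case: (P m); rewrite ?coefm0 ?coefm_term ?(negPf nmk); case: ifP.
Qed.

(** The hypothesis says that P is closed under products and that its complement
    is an ideal of monomials: the discarded part is then an ideal of A. *)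
Lemma restrM a b : (forall m k, P (mmul m k) = P m && P k) ->
  restr P (a * b) = restr P a * restr P b.
Proof.
move=> PM; elim/polyInf_ind: a => [|a a' aE a'E|c m].
- by rewrite mul0r restr0 mul0r.
- by rewrite [in RHS]restrD !mulrDl restrD; congr (_ + _); [exact: aE | exact: a'E].
elim/polyInf_ind: b => [|b b' bE b'E|d k].
- by rewrite mulr0 restr0 mulr0.
- by rewrite [in RHS]restrD !mulrDr restrD; congr (_ + _); [exact: bE | exact: b'E].
rewrite termM !restr_term PM.
by case: (P m) (P k) => [] [] /=; rewrite ?termM ?mulr0 ?mul0r.
Qed.

End Restriction.

Lemma dvd_theta i a :
  principal_ideal (theta K i) a <-> restr (fun m : mono => m i == 0%N) a = 0.
Proof.
set P := (X in restr X).
have PM m k : P (mmul m k) = P m && P k by rewrite /P cmM addn_eq0.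
split=> [[b ->]|a0].
  by rewrite restrM // theta_term [restr _ (term _ _)]restr_term /P cmUU mulr0.
exists (\sum_(k <- supp a) term (coefm a k) (divcm k (ucm i))).
rewrite theta_term big_distrl [LHS]supp_sum /=; apply: eq_big_seq => k ak.
rewrite termM mulr1; congr term; apply/eqP/cmP => j.
rewrite mulcmE divcmE ucmE; case: eqP => [<-|_]; last by rewrite subn0 addn0.
rewrite subnK // lt0n; apply: contraTneq ak => ki.
rewrite mem_supp negbK; have := congr1 (fun x : A => coefm x k) a0.
by rewrite /= coefm_restr /P ki eqxx coefm0 => ->.
Qed.

Lemma ndvd_theta i a m : m i = 0%N -> coefm a m != 0 -> ~ principal_ideal (theta K i) a.
Proof.
move=> mi am /dvd_theta/(congr1 (fun x : A => coefm x m)).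
by rewrite /= coefm_restr mi eqxx coefm0 => /eqP; apply/negP.
Qed.

Lemma theta_neq0 i : theta K i != 0.
Proof.
apply/eqP => /(congr1 (fun x : A => coefm x (ucm i)))/eqP.
by rewrite /= theta_term coefm_term coefm0 eqxx oner_eq0.
Qed.

Lemma theta_prime i a b : principal_ideal (theta K i) (a * b) ->
  principal_ideal (theta K i) a \/ principal_ideal (theta K i) b.
Proof.
rewrite !dvd_theta restrM => [|m k]; last by rewrite cmM addn_eq0.
exact: polyInf_domain.
Qed.

Lemma theta_compl1 : theta_compl (1 : A).
Proof.
move=> i; apply: (@ndvd_theta i _ mone); rewrite ?cm1 //.
by rewrite one_term coefm_term eqxx oner_eq0.
Qed.

(** Modulo theta_k with k <> i, the monomial theta_i survives and cannot be
    cancelled by theta_j; if k = i, theta_j survives instead. *)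
Lemma theta_complD i j : i != j -> theta_compl (theta K i + theta K j).
Proof.
suff dvdF (i' j' k : nat) : i' != j' -> i' != k ->
    ~ principal_ideal (theta K k) (theta K i' + theta K j').
  move=> ij k; have [<-|ki] := eqVneq i k; last exact: dvdF.
  by rewrite addrC; apply: dvdF; rewrite eq_sym // eq_sym.
move=> ij ik; apply: (@ndvd_theta k _ (ucm i')); first by rewrite cmU (negPf ik).
rewrite !theta_term coefmD !coefm_term eqxx.
rewrite (_ : (ucm j' == ucm i') = false) ?addr0 ?oner_eq0 //.
apply/negP => /cmP/(_ i').
by rewrite !cmU eqxx eq_sym (negPf ij).
Qed.

(** Dividing by a theta lowers the degree of a monomial of the support. *)
Lemma theta_factor a : a != 0 ->
  exists s (l : seq nat), theta_compl s /\ a = s * \prod_(i <- l) theta K i.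
Proof.
move=> a0; have [m am] := supp_neq0 a0.
have [d] := ubnP (mdeg m); elim: d => // d IHd in a a0 m am *; rewrite ltnS => md.
have [Sa|/existsNP[i /contrapT[b aE]]] := pselect (theta_compl a).
  by exists a, [::]; rewrite big_nil mulr1.
have b0 : b != 0 by apply: contra_neq a0 => b0; rewrite aE b0 mul0r.
have [k bk mE] : exists2 k, k \in supp b & m = mmul k (ucm i).
  apply: contrapT => /forall2NP mP; move: am; rewrite mem_supp aE theta_term.
  rewrite {1}[b]supp_sum big_distrl /= => /eqP; apply.
  rewrite big_seq; elim/big_ind: _ => [|x y x0 y0|k bk]; first exact: coefm0.
    by rewrite coefmD x0 y0 addr0.
  rewrite termM coefm_term; case: eqP => // mE.
  by case: (mP k) => [|] [].
have ltk : (mdeg k < d)%N by rewrite (leq_trans _ md) // mE mdegM mdegU addn1.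
have [s [l [Ss bE]]] := IHd b b0 k bk ltk.
exists s, (i :: l); split; first exact: Ss.
(* Proved in an abstract ring, where unification does not unfold products. *)
have mulE (B : comNzRingType) (x y z : B) : x * y * z = x * (z * y).
  by rewrite -mulrA [y * z]mulrC.
by rewrite big_cons aE bE; apply: mulE.
Qed.

End PolyInf.

(** * The Frobenius splitting of the polynomial ring *)

Lemma frobD (R : comNzRingType) p (charR : p \in [pchar R]) (a b : R) :
  (a + b) ^+ p = a ^+ p + b ^+ p.
Proof. exact: (rmorphD (pFrobenius_aut charR) a b). Qed.

Section PthPowerPart.
Variables (K : fieldType) (p : nat).
Hypothesis charK : p \in [pchar K].
Local Notation A := (polyInf K).
Implicit Types (a b : A) (m k : mono) (c d : K).

Let p_gt0 : (0 < p)%N := prime_gt0 (pcharf_prime charK).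

Let charA : p \in [pchar A] :=
  rmorph_pchar (malgC : {rmorphism K -> {malg K[{cmonom nat}]}}) charK.

(** The projection of A onto the span of the p-th powers of monomials; the
    Frobenius splitting is its p-th root. *)
Definition pth_power_part : A -> A :=
  restr (fun m : mono => `[< forall i, (p %| m i)%N >]).

Lemma termX c m n : exists2 k, (term c m : A) ^+ n = term (c ^+ n) k &
  forall i, k i = (n * m i)%N.
Proof.
elim: n => [|n [k cmn kE]].
  by exists mone; [rewrite !expr0 one_term | move=> i; rewrite cm1 mul0n].
exists (mmul m k); first by rewrite exprS cmn termM exprS.
by move=> i; rewrite cmM kE mulSn.
Qed.

Lemma pth_power_partD : {morph pth_power_part : a b / a + b}.
Proof. exact: restrD. Qed.

Lemma pth_power_part1 : pth_power_part 1 = 1.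
Proof.
by rewrite one_term [LHS]restr_term; case: asboolP => // -[]i; rewrite cm1 dvdn0.
Qed.

(** By additivity in both arguments only monomials matter, and multiplying by
    the p-th power of a monomial does not change the residues of the exponents
    modulo p. *)
Lemma pth_power_part_semilinear a b :
  pth_power_part (a ^+ p * b) = a ^+ p * pth_power_part b.
Proof.
rewrite /pth_power_part; elim/polyInf_ind: a => [|a a' aE a'E|c m].
- by rewrite expr0n -[p == _]negbK -lt0n p_gt0 !mul0r restr0.
- rewrite [in LHS](frobD charA) [in RHS](frobD charA) mulrDl restrD mulrDl.
  by congr (_ + _); [exact: aE | exact: a'E].
have [k -> kE] := termX c m p.
elim/polyInf_ind: b => [|b b' bE b'E|d l].
- by rewrite mulr0 restr0 mulr0.
- by rewrite [in RHS]restrD !mulrDr restrD; congr (_ + _); [exact: bE | exact: b'E].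
rewrite termM !restr_term.
suff -> : `[< forall i, (p %| mmul k l i)%N >] = `[< forall i, (p %| l i)%N >].
  by case: ifP; rewrite ?termM ?mulr0.
by apply: asbool_equiv_eq; split=> dvd i; have := dvd i;
  rewrite cmM kE dvdn_addr ?dvdn_mulr.
Qed.

Lemma pth_power_partP (perfK : perfect_field K p) a :
  exists b, b ^+ p = pth_power_part a.
Proof.
rewrite /pth_power_part; elim/polyInf_ind: a => [|a a' [b bE] [b' b'E]|c m].
- by exists 0; rewrite restr0 expr0n -[p == _]negbK -lt0n p_gt0.
- by exists (b + b'); rewrite (frobD charA) restrD; congr (_ + _); [exact: bE | exact: b'E].
rewrite restr_term; case: asboolP => [dvdm|_]; last first.
  by exists 0; rewrite expr0n -[p == _]negbK -lt0n p_gt0.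
have [d dE] := perfK c.
pose h : mono := [cmonom (m i %/ p)%N | i in finsupp m]%M.
have [k kE kh] := termX d h p.
exists (term d h); rewrite kE dE; congr term; apply/eqP/cmP => i.
rewrite kh [(p * _)%N]mulnC /h cmE /= fsfunE.
by case: ifPn => [_|]; rewrite ?divnK // -cmE_eq0 => /eqP ->.
Qed.

Lemma pth_power_part_theta i a : principal_ideal (theta K i) a ->
  principal_ideal (theta K i) (pth_power_part a).
Proof.
rewrite !dvd_theta => a0; apply: coefmP => m.
have := congr1 (fun x : A => coefm x m) a0.
by rewrite /= !coefm_restr coefm0; case: ifP => // _ ->; case: ifP.
Qed.

End PthPowerPart.

(** * Domains generated by units and pairwise comaximal primes *)

Section PrimeProducts.
Variables (R : comNzRingType) (T : nat -> R).
Hypothesis domR : forall x y : R, x * y = 0 -> x = 0 \/ y = 0.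
Hypothesis T_neq0 : forall i, T i != 0.
Hypothesis T_prime : forall i, Spec (principal_ideal (T i)).
Hypothesis T_comax : forall i j, i != j -> exists x y, x * T i + y * T j = 1.
Hypothesis T_factor : forall r, r != 0 ->
  exists u v l, u * v = 1 /\ r = u * \prod_(i <- l) T i.

Local Notation pr l := (\prod_(i <- l) T i).

Lemma comax_prod i (l : seq nat) :
  i \notin l -> exists x y, x * T i + y * pr l = 1.
Proof.
elim: l => [|j l IHl]; first by exists 0, 1; rewrite big_nil mul0r add0r mulr1.
rewrite in_cons negb_or => /andP[ij /IHl[x [y xy1]]].
have [x' [y' xy1']] := T_comax ij.
exists (x * x' * T i + x * y' * T j + y * pr l * x'), (y * y').
rewrite big_cons; transitivity ((x * T i + y * pr l) * (x' * T i + y' * T j)).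
  by ring.
by rewrite xy1 xy1' mulr1.
Qed.

Lemma comax_notin i r :
  ~ principal_ideal (T i) r -> exists x y, x * T i + y * r = 1.
Proof.
move=> ir; have r0 : r != 0 by apply/eqP => r0; apply: ir; exists 0; rewrite mul0r.
have [u [v [l [uv1 rE]]]] := T_factor r0.
have il : i \notin l.
  apply/negP => il; apply: ir; exists (u * pr (rem i l)).
  by rewrite rE (big_rem i il) /=; ring.
have [x [y xy1]] := comax_prod il.
exists x, (y * v); rewrite -xy1 rE; congr (_ + _).
by transitivity (y * pr l * (u * v)); [ring | rewrite uv1 mulr1].
Qed.

(** Either the first product divides the second, or the ideal generated by both
    contains a strictly shorter product: a factor T i common to both is carried
    along, and a factor T i absent from l' is invertible modulo pr l' and can be
    dropped. *)
Lemma gcd_prod (l l' : seq nat) : (exists c, pr l' = c * pr l) \/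
  exists e x y, (size e < size l)%N /\ pr e = x * pr l + y * pr l'.
Proof.
elim: l l' => [|i l IHl] l'; first by left; exists (pr l'); rewrite big_nil mulr1.
rewrite big_cons; have [il'|il'] := boolP (i \in l').
  rewrite (big_rem i il') /=; have [[c ->]|[e [x [y [lte eE]]]]] := IHl (rem i l').
    by left; exists c; ring.
  by right; exists (i :: e), x, y; split=> //; rewrite big_cons eE; ring.
have [x [y xy1]] := comax_prod il'; right.
have [[c l'E]|[e [a [b [lte eE]]]]] := IHl l'.
  exists l, x, (y * pr l); split=> //=.
  by transitivity (pr l * (x * T i + y * pr l')); [rewrite xy1 mulr1 | ring].
exists e, (a * x), (a * y * pr l + b); split; first exact: ltnW.
rewrite eE; transitivity (a * pr l * (x * T i + y * pr l') + b * pr l').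
  by rewrite xy1 mulr1.
by ring.
Qed.

(** A product of least length in I divides every element of I, since otherwise
    [gcd_prod] would give a shorter one. *)
Lemma ideal_principal (I : set R) : is_ideal I ->
  exists2 g, I g & forall r, I r -> exists c, r = c * g.
Proof.
move=> [I0 Ilin].
have IM a u : I u -> I (a * u) by move=> Iu; rewrite -[_ * _]addr0; apply: Ilin.
have prod_in r : I r -> r != 0 -> exists u l, r = u * pr l /\ I (pr l).
  move=> Ir /T_factor[u [v [l [uv1 rE]]]]; exists u, l; split=> //.
  have -> : pr l = v * r by rewrite rE mulrA [v * u]mulrC uv1 mul1r.
  exact: IM.
have [[r Ir /eqP r0]|I_eq0] := pselect (exists2 r, I r & r <> 0); last first.
  exists 0 => // r Ir; exists 0; rewrite mul0r.
  by apply: contrapT => r0; apply: I_eq0; exists r.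
have [_ [l [_ Il]]] := prod_in r Ir r0.
have [n] := ubnP (size l); elim: n l Il => // n IHn l Il; rewrite ltnS => ln.
have [Idvd|/existsNP[s /not_implyP[Is sNdvd]]] :=
  pselect (forall r, I r -> exists c, r = c * pr l); first by exists (pr l).
have s0 : s != 0 by apply/eqP => s0; apply: sNdvd; exists 0; rewrite mul0r.
have [u [l' [sE Il']]] := prod_in s Is s0.
have [[c l'E]|[e [x [y [lte eE]]]]] := gcd_prod l l'.
  by case: sNdvd; exists (u * c); rewrite sE l'E mulrA.
apply: (IHn e); last exact: leq_trans lte ln.
by rewrite eE; apply: Ilin => //; apply: IM.
Qed.

Lemma ideal_acc (I : nat -> set R) : (forall i, is_ideal (I i)) ->
  (forall i, I i `<=` I i.+1) ->
  exists k, forall i, (k <= i)%N -> I i `<=` I k.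
Proof.
move=> idI Isub.
have Ile i j : (i <= j)%N -> I i `<=` I j.
  move=> /subnK <-; elim: (j - i)%N => // d IHd r /IHd; exact: Isub.
have [|g [k _ Ig] gP] := @ideal_principal (\bigcup_i I i).
  split=> [|a u v [i _ Iu] [j _ Iv]]; first by exists 0%N; case: (idI 0%N).
  exists (maxn i j) => //; apply: (idI _).2.
  - exact: (Ile i _ (leq_maxl i j) _ Iu).
  - exact: (Ile j _ (leq_maxr i j) _ Iv).
exists k => i ki r Ir; have [|c ->] := gP r; first by exists i.
by rewrite -[c * g]addr0; case: (idI k) => ? Ilin; apply: Ilin.
Qed.

(** The chain 0, (T 0) has length 1.  In a longer chain P 0, P 1, P 2 the
    nonzero prime P 1 contains some T i by factoring one of its elements, and
    any element of P 2 outside P 1 is comaximal with T i, so that P 2 contains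
    1. *)
Lemma krull_dim_prime_products : has_krull_dim R 1.
Proof.
split.
  exists (fun i => if i is 0%N then [set 0] else principal_ideal (T 0%N)); split.
    case=> [|i] _; last exact: T_prime.
    split=> [|/eqP|a b /domR//]; last by rewrite oner_eq0.
    by split=> // a u v -> ->; rewrite mulr0 addr0.
  case=> // _; split=> [r ->|sub0]; first by exists 0; rewrite mul0r.
  have /sub0/eqP : principal_ideal (T 0%N) (T 0%N) by exists 1; rewrite mul1r.
  by rewrite (negPf (T_neq0 _)).
move=> [P [primeP ltP]].
have [/= [P00 _] _ _] := primeP 0%N isT; have [[P10 P1lin] P1N1 P1p] := primeP 1%N isT.
have [[P20 P2lin] P2N1 _] := primeP 2%N isT.
have [r P1r P0r] : exists2 r, P 1%N r & ~ P 0%N r.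
  by have [_ /existsNP[r /not_implyP[]]] := ltP 0%N isT; exists r.
have [s P2s P1s] : exists2 s, P 2%N s & ~ P 1%N s.
  by have [_ /existsNP[s /not_implyP[]]] := ltP 1%N isT; exists s.
have [P12 _] := ltP 1%N isT.
have r0 : r != 0 by apply/eqP => r0; apply: P0r; rewrite r0.
have P1M x y : P 1%N x -> P 1%N (y * x).
  by move=> Px; rewrite -[_ * _]addr0; apply: P1lin.
have P2M x y : P 2%N x -> P 2%N (y * x).
  by move=> Px; rewrite -[_ * _]addr0; apply: P2lin.
have [i P1i] : exists i, P 1%N (T i).
  have [u [v [l [uv1 rE]]]] := T_factor r0.
  have : P 1%N (pr l).
    have -> : pr l = v * r by rewrite rE mulrA [v * u]mulrC uv1 mul1r.
    exact: P1M.
  elim: l {rE} => [|i l IHl]; first by rewrite big_nil => /P1N1.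
  by rewrite big_cons => /P1p[|/IHl//]; exists i.
have [|x [y xy1]] := @comax_notin i s.
  by move=> [c sE]; apply: P1s; rewrite sE; apply: P1M.
apply: P2N1; rewrite -xy1; apply: P2lin; first exact: P12.
exact: P2M.
Qed.

End PrimeProducts.

(** * Localization at a family of primes *)

(** For t = theta this is [theta_compl].  The ring A is kept abstract so that
    its products are never unfolded into the monoid algebra. *)
Definition avoiding (A : comNzRingType) (t : nat -> A) : set A :=
  [set s | forall i, ~ principal_ideal (t i) s].

(** The properties of the theta's on which the ring theory of the localization
    rests.  [cop_add] makes the t i pairwise comaximal once the elements of
    [avoiding t] are inverted. *)
Record comaximal_primes (A : comNzRingType) (t : nat -> A) : Prop := {
  cop_domain : forall a b : A, a * b = 0 -> a = 0 \/ b = 0;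
  cop_neq0 : forall i, t i != 0;
  cop_prime : forall i a b, principal_ideal (t i) (a * b) ->
    principal_ideal (t i) a \/ principal_ideal (t i) b;
  cop_one : avoiding t 1;
  cop_add : forall i j, i != j -> avoiding t (t i + t j);
  cop_factor : forall a, a != 0 ->
    exists s (l : seq nat), avoiding t s /\ a = s * \prod_(i <- l) t i
}.

Section Localization.
Variables (A R : comNzRingType) (t : nat -> A) (phi : {rmorphism A -> R}).
Hypothesis copt : comaximal_primes t.
Local Notation S := (avoiding t).
Hypothesis locR : is_localization S phi.

Lemma avoidingM a b : S a -> S b -> S (a * b).
Proof. by move=> Sa Sb i /(cop_prime copt)[/Sa|/Sb]. Qed.

Lemma avoiding_neq0 s : S s -> s <> 0.
Proof. by move=> Ss s0; apply: (Ss 0%N); exists 0; rewrite mul0r. Qed.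

Lemma loc_inj : injective phi.
Proof.
move=> a b /(loc_eq locR)[s [Ss sab]]; apply/eqP; rewrite -subr_eq0; apply/eqP.
have /(cop_domain copt)[/(avoiding_neq0 Ss)//|//] : s * (a - b) = 0.
by rewrite mulrBr sab subrr.
Qed.

Lemma loc_mulI s : S s -> injective (fun x => x * phi s).
Proof.
move=> Ss x y xy; have [u su1] := loc_unit locR Ss.
by rewrite -[x]mulr1 -[y]mulr1 -su1 !mulrA xy.
Qed.

Lemma loc_domain (x y : R) : x * y = 0 -> x = 0 \/ y = 0.
Proof.
have [a [s [Ss xE]]] := loc_frac locR x; have [b [s' [Ss' yE]]] := loc_frac locR y.
move=> xy0; have : phi (a * b) = phi 0.
  by rewrite rmorphM rmorph0 -xE -yE mulrACA xy0 mul0r.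
move=> /loc_inj/(cop_domain copt)[a0|b0]; [left|right].
  by apply: (loc_mulI Ss); rewrite /= xE a0 rmorph0 mul0r.
by apply: (loc_mulI Ss'); rewrite /= yE b0 rmorph0 mul0r.
Qed.

Lemma loc_idealE i : loc_ideal S phi (principal_ideal (t i)) = principal_ideal (phi (t i)).
Proof.
apply/seteqP; split=> [r [a [s [[b ->] Ss rE]]]|r [x ->]].
  have [u su1] := loc_unit locR Ss; exists (phi b * u).
  by rewrite -[r]mulr1 -su1 mulrA rE rmorphM mulrAC.
have [a [s [Ss xE]]] := loc_frac locR x; exists (a * t i), s; split=> //.
  by exists a.
by rewrite mulrAC xE rmorphM.
Qed.

Lemma loc_principal_phi i a : principal_ideal (phi (t i)) (phi a) <-> principal_ideal (t i) a.
Proof.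
split=> [|[b ->]]; last by exists (phi b); rewrite rmorphM.
rewrite -loc_idealE => -[b [s [ib Ss asb]]].
have asE : a * s = b by apply: loc_inj; rewrite rmorphM.
by move: ib; rewrite -asE => /(cop_prime copt)[|/Ss].
Qed.

Lemma loc_principal_frac i s x : S s ->
  principal_ideal (phi (t i)) (x * phi s) -> principal_ideal (phi (t i)) x.
Proof.
move=> Ss [y xE]; have [u su1] := loc_unit locR Ss; exists (y * u).
by rewrite -[x]mulr1 -su1 mulrA xE mulrAC.
Qed.

Lemma is_ideal_principal (B : comNzRingType) (g : B) : is_ideal (principal_ideal g).
Proof.
split=> [|a u v [x ->] [y ->]]; first by exists 0; rewrite mul0r.
by exists (a * x + y); rewrite mulrDl mulrA.
Qed.

Lemma principalM (B : comNzRingType) (g x y : B) :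
  principal_ideal g x -> principal_ideal g (x * y).
Proof. by move=> [z ->]; exists (z * y); rewrite mulrAC. Qed.

Lemma loc_Spec i : Spec (principal_ideal (phi (t i))).
Proof.
split=> [||x y]; first exact: is_ideal_principal.
  by rewrite -(rmorph1 phi) => /loc_principal_phi; apply: (cop_one copt).
have [a [s [Ss xE]]] := loc_frac locR x; have [b [s' [Ss' yE]]] := loc_frac locR y.
move=> /(principalM (phi s * phi s')); rewrite mulrACA xE yE -rmorphM.
move=> /loc_principal_phi/(cop_prime copt)[]/loc_principal_phi.
  by rewrite -xE => /(loc_principal_frac Ss); left.
by rewrite -yE => /(loc_principal_frac Ss'); right.
Qed.

Lemma loc_neq0 i : phi (t i) != 0.
Proof.
apply: contra_neq (cop_neq0 copt i) => ti0.
by apply: loc_inj; rewrite ti0 rmorph0.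
Qed.

Lemma loc_comax i j : i != j -> exists x y, x * phi (t i) + y * phi (t j) = 1.
Proof.
move=> /(cop_add copt)/(loc_unit locR)[u u1]; exists u, u.
by rewrite -mulrDr -rmorphD mulrC.
Qed.

Lemma loc_factor r : r != 0 ->
  exists u v l, u * v = 1 /\ r = u * \prod_(i <- l) phi (t i).
Proof.
have [a [s [Ss rE]]] := loc_frac locR r => r0.
have a0 : a != 0.
  apply: contra_neq r0 => a0; apply: (loc_mulI Ss).
  by rewrite /= rE a0 rmorph0 mul0r.
have [s' [l [Ss' aE]]] := cop_factor copt a0.
have [u su1] := loc_unit locR Ss; have [u' su1'] := loc_unit locR Ss'.
exists (phi s' * u), (u' * phi s), l; split.
  by rewrite mulrACA su1' mul1r mulrC su1.
transitivity (r * (phi s * u)); first by rewrite su1 mulr1.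
by rewrite mulrA rE aE rmorphM rmorph_prod; ring.
Qed.

Lemma loc_notin_neq i j : i != j -> ~ principal_ideal (phi (t i)) (phi (t j)).
Proof.
move=> ij /loc_principal_phi[b tjE]; apply: (cop_add copt ij (i := i)).
by exists (1 + b); rewrite mulrDl mul1r tjE.
Qed.

(** The localized Frobenius splitting.  Its value b at r is determined by
    b^p = pth (a) / s^p for any expression r = a / s^p with s avoiding the
    primes; such an expression exists because a / s = a s^(p-1) / s^p. *)
Section CartierMap.
Variables (p : nat) (pth : A -> A).
Hypothesis charR : p \in [pchar R].
Hypothesis pthD : {morph pth : a b / a + b}.
Hypothesis pthM : forall a b, pth (a ^+ p * b) = a ^+ p * pth b.
Hypothesis pth1 : pth 1 = 1.
Hypothesis pthP : forall a, exists b, b ^+ p = pth a.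
Hypothesis pth_ideal : forall i a,
  principal_ideal (t i) a -> principal_ideal (t i) (pth a).

Let p_gt0 : (0 < p)%N := prime_gt0 (pcharf_prime charR).

Lemma loc_frob_inj (x y : R) : x ^+ p = y ^+ p -> x = y.
Proof.
have frob0 n (z : R) : z ^+ n = 0 -> z = 0.
  elim: n => [/eqP|n IHn]; first by rewrite expr0 oner_eq0.
  by rewrite exprS => /loc_domain[|/IHn].
move=> xyp; apply/eqP; rewrite -subr_eq0; apply/eqP; apply: (frob0 p).
have := frobD charR (x - y) y; rewrite subrK xyp.
by rewrite -{1}[y ^+ p]add0r => /addIr.
Qed.

Let root_of (r b : R) : Prop := exists a s,
  [/\ S s, r * phi s ^+ p = phi a & (b * phi s) ^+ p = phi (pth a)].

Let root_of_total r : exists b, root_of r b.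
Proof.
have [a [s [Ss rE]]] := loc_frac locR r.
have [c cE] := pthP (a * s ^+ p.-1); have [u su1] := loc_unit locR Ss.
exists (phi c * u), (a * s ^+ p.-1), s; split=> //.
  by rewrite -{1}(prednK p_gt0) exprS mulrA rE rmorphM rmorphXn.
by rewrite -mulrA [u * _]mulrC su1 mulr1 -rmorphXn cE.
Qed.

Let root_of_fun r b b' : root_of r b -> root_of r b' -> b = b'.
Proof.
move=> [a [s [Ss rE bE]]] [a' [s' [Ss' rE' bE']]].
have aE : s' ^+ p * a = s ^+ p * a'.
  apply: loc_inj; rewrite !rmorphM !rmorphXn -rE -rE'.
  by rewrite mulrCA [RHS]mulrCA [_ ^+ p * _]mulrC.
apply/(loc_mulI (avoidingM Ss Ss'))/loc_frob_inj.
have -> : b * phi (s * s') = phi s' * (b * phi s) by rewrite rmorphM; ring.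
have -> : b' * phi (s * s') = phi s * (b' * phi s') by rewrite rmorphM; ring.
by rewrite exprMn [RHS]exprMn bE bE' -!rmorphXn -!rmorphM -!pthM aE.
Qed.

Lemma cartier_map : exists C : R -> R,
  [/\ {morph C : x y / x + y}, forall c m, C (c ^+ p * m) = c * C m, C 1 = 1 &
      forall i r, principal_ideal (phi (t i)) r -> principal_ideal (phi (t i)) (C r)].
Proof.
have [C CP] := choice root_of_total; exists C; split.
- move=> x y; apply: root_of_fun (CP _) _.
  have [a [s [Ss xE aE]]] := CP x; have [b [s' [Ss' yE bE]]] := CP y.
  exists (s' ^+ p * a + s ^+ p * b), (s * s'); split; first exact: avoidingM.
    by rewrite rmorphD !rmorphM !rmorphXn -xE -yE exprMn; ring.
  rewrite pthD !pthM rmorphD !rmorphM !rmorphXn -aE -bE -!exprMn -(frobD charR).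
  by congr (_ ^+ _); ring.
- move=> c m; apply: root_of_fun (CP _) _.
  have [a [s [Ss mE aE]]] := CP m; have [e [s' [Ss' cE]]] := loc_frac locR c.
  exists (e ^+ p * a), (s' * s); split; first exact: avoidingM.
    by rewrite !rmorphM !rmorphXn -mE -cE !exprMn; ring.
  rewrite pthM !rmorphM rmorphXn -aE -cE -exprMn.
  by congr (_ ^+ _); ring.
- apply: root_of_fun (CP _) _; exists 1, 1.
  by rewrite pth1 !rmorph1 expr1n mulr1 expr1n; split=> //; apply: cop_one copt.
move=> i r ir; have [a [s [Ss rE aE]]] := CP r; apply: (loc_principal_frac Ss).
have : principal_ideal (phi (t i)) ((C r * phi s) ^+ p).
  rewrite aE; apply/loc_principal_phi/pth_ideal/loc_principal_phi.
  by rewrite -rE; apply: principalM.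
have [_ N1 prime_i] := loc_Spec i.
elim: p => [|n IHn]; first by rewrite expr0 => /N1.
by rewrite exprS => /prime_i[|/IHn].
Qed.

End CartierMap.
End Localization.

(** * The right module defined by a Cartier map *)

Section CartierModule.
Variables (R : comNzRingType) (p : nat) (charRp : p \in [pchar R]) (C : R -> R).
Hypothesis CD : {morph C : x y / x + y}.
Hypothesis CM : forall c m, C (c ^+ p * m) = c * C m.
Hypothesis C1 : C 1 = 1.
Local Notation sk := (frobSkew charRp).

Lemma iter_cartierD n : {morph iter n C : x y / x + y}.
Proof. by elim: n => // n IHn x y; rewrite /= IHn CD. Qed.

Lemma iter_cartier0 n : iter n C 0 = 0.
Proof.
by have := iter_cartierD n 0 0; rewrite addr0 -{1}[iter n C 0]addr0 => /addrI.
Qed.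

Lemma iter_cartier1 n : iter n C 1 = 1.
Proof. by elim: n => //= n ->. Qed.

Lemma iter_cartierM n c m : iter n C (c ^+ (p ^ n) * m) = c * iter n C m.
Proof.
elim: n c m => [|n IHn] c m; first by rewrite expn0 expr1.
by rewrite expnS exprM !iterS IHn CM.
Qed.

(** The action m (sum_i u_i x^i) = sum_i C^i (m u_i). *)
Definition cartier_scale (u : {poly R}) (m : R) : R :=
  \sum_(i < size u) iter i C (m * u`_i).

Lemma cartier_scale_wide n (u : {poly R}) m : (size u <= n)%N ->
  cartier_scale u m = \sum_(i < n) iter i C (m * u`_i).
Proof.
move=> un; rewrite /cartier_scale (big_ord_widen n (fun i => iter i C (m * u`_i))) //.
rewrite big_mkcond /=; apply: eq_bigr => i _; case: ltnP => // ui.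
by rewrite nth_default // mulr0 iter_cartier0.
Qed.

Lemma cartier_scaleDl m : {morph cartier_scale^~ m : u v / u + v}.
Proof.
move=> u v; pose n := maxn (size u) (size v).
rewrite !(@cartier_scale_wide n) ?leq_maxl ?leq_maxr ?size_polyD //.
rewrite -big_split; apply: eq_bigr => i _.
by rewrite coefD mulrDr iter_cartierD.
Qed.

Lemma cartier_scaleDr u : {morph cartier_scale u : m n / m + n}.
Proof.
move=> m n; rewrite -big_split; apply: eq_bigr => i _.
by rewrite mulrDl iter_cartierD.
Qed.

Lemma cartier_scale0l m : cartier_scale 0 m = 0.
Proof. by rewrite /cartier_scale size_poly0 big_ord0. Qed.

Lemma cartier_scale0r u : cartier_scale u 0 = 0.
Proof. by rewrite /cartier_scale big1 // => i _; rewrite mul0r iter_cartier0. Qed.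

Lemma cartier_scale_mono r i m : cartier_scale (skewM charRp r i) m = iter i C (m * r).
Proof.
rewrite (@cartier_scale_wide i.+1); last first.
  by rewrite (leq_trans (size_scale_leq _ _)) // size_polyXn.
rewrite big_ord_recr /= big1 => [|j _].
  by rewrite add0r coefZ coefXn eqxx mulr1.
by rewrite coefZ coefXn ltn_eqF // mulr0 mulr0 iter_cartier0.
Qed.

Lemma skew_ind (Q : sk -> Prop) : Q 0 -> (forall u v, Q u -> Q v -> Q (u + v)) ->
  (forall r i, Q (skewM charRp r i)) -> forall u, Q u.
Proof.
move=> Q0 QD Qm u; rewrite -[u](@coefK R) poly_def.
by elim/(@big_ind {poly R}): _ => // i _; apply: Qm.
Qed.

(** On monomials this is C^j (C^i (m r) s) = C^(i+j) (m r s^(p^i)), the image of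
    the commutation rule x s = s^p x. *)
Lemma cartier_scaleA (a b : sk^c) m :
  cartier_scale a (cartier_scale b m) = cartier_scale (a * b : sk^c) m.
Proof.
(* Unfold the opposite ring, so that the skew product itself appears. *)
change (cartier_scale a (cartier_scale b m) = cartier_scale ((b : sk) * (a : sk)) m).
elim/skew_ind: a => [|u v uE vE|r i].
- by rewrite cartier_scale0l mulr0 cartier_scale0l.
- by rewrite mulrDr !cartier_scaleDl uE vE.
elim/skew_ind: b => [|u v uE vE|s j].
- by rewrite cartier_scale0l cartier_scale0r mul0r cartier_scale0l.
- by rewrite mulrDl !cartier_scaleDl cartier_scaleDr uE vE.
rewrite skewMM !cartier_scale_mono [(j + i)%N]addnC iterD; congr (iter i C _).
by rewrite mulrC -iter_cartierM; congr iter; ring.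
Qed.

Lemma cartier_scale1 : left_id (1 : sk^c) cartier_scale.
Proof.
move=> m; have -> : (1 : sk^c) = skewM charRp 1 0 by rewrite /skewM scale1r.
by rewrite cartier_scale_mono mulr1.
Qed.

Definition cartier_structure : right_structure charRp :=
  GRing.Zmodule_isLmodule.Build sk^c R
    cartier_scaleA cartier_scale1 cartier_scaleDr cartier_scaleDl.

End CartierModule.

(** * Quotients, their graded annihilators and special ideals *)

Section HomomorphicImages.
Variables (R : comNzRingType) (p : nat) (charRp : p \in [pchar R]).
Variables (M : rightModType charRp) (N : submodClosed M).
Local Notation sk := (frobSkew charRp).

Lemma quot_proj_linear : linear (@quot_proj R p charRp M N).
Proof.
move=> a m n; rewrite quot_projD; congr (_ + _).
exact: (esym (quotmod_scaleE N a m)).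
Qed.

Lemma quot_proj_eq0 (m : M) : quot_proj N m = 0 <-> m \in N.
Proof.
have <- : quot_proj N (0 : M) = 0.
  by apply: (addrI (quot_proj N 0)); rewrite -quot_projD !addr0.
by rewrite -[m in m \in N]subr0 -quot_projE; split=> /eqP.
Qed.

Lemma gr_ann_quotmod (u : sk) : gr_ann (quotmod N) u <->
  forall i (m : M), ract m (skewM charRp (u : {poly R})`_i i) \in N.
Proof.
have ractE (m : M) (v : sk) :
    ract (quot_proj N m : quotmod N) v = quot_proj N (ract m v).
  exact: quotmod_scaleE.
split=> [uN i m|uN i h]; first by apply/quot_proj_eq0; rewrite -ractE; apply: uN.
by rewrite -[h]quot_reprK ractE; apply/quot_proj_eq0; apply: uN.
Qed.

Lemma gr_ann_images_quotmod : gr_ann_images M (gr_ann (quotmod N)).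
Proof.
pose h : {linear M -> quotmod N} := HB.pack (@quot_proj R p charRp M N)
  (GRing.isLinear.Build sk^c M (quotmod N) *:%R (@quot_proj R p charRp M N)
     quot_proj_linear).
exists (quotmod N), h; split=> // y; exists (repr (y : {ideal_quot submod_zmod N})).
exact: quot_reprK.
Qed.

End HomomorphicImages.

(** An ideal is recovered as the degree 0 part of its extension. *)
Lemma graded_extension_inj (R : comNzRingType) (p : nat) (charRp : p \in [pchar R])
    (b c : set R) : graded_extension (charRp := charRp) b = graded_extension c ->
  is_ideal b -> is_ideal c -> b = c.
Proof.
move=> bc [b0 _] [c0 _].
have constE (d : set R) r : d 0 -> graded_extension (charRp := charRp) d r%:P <-> d r.
  move=> d0; split=> [/(_ 0%N)|dr [|i]]; rewrite coefC //.
by apply/seteqP; split=> r; rewrite -(constE b) // -(constE c) // bc.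
Qed.

Section CartierSpecialIdeals.
Variables (R : comNzRingType) (p : nat) (charRp : p \in [pchar R]) (C : R -> R).
Hypothesis CD : {morph C : x y / x + y}.
Hypothesis CM : forall c m, C (c ^+ p * m) = c * C m.
Hypothesis C1 : C 1 = 1.
Local Notation sk := (frobSkew charRp).
Local Notation M := (right_module_of (cartier_structure charRp CD CM)).

Lemma ract_cartier (m : M) r i : ract m (skewM charRp r i) = iter i C ((m : R) * r).
Proof. exact: (cartier_scale_mono charRp CD). Qed.

Lemma cartier_extends : extends_regular (cartier_structure charRp CD CM).
Proof. by move=> r m; rewrite ract_cartier. Qed.

Lemma cartier_x_divisible : x_divisible M.
Proof.
move=> m; exists ((m : R) ^+ p : R); rewrite ract_cartier /= CM C1.
by rewrite mulr1.
Qed.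

Section StableIdeal.
Variable b : set R.
Hypothesis idb : is_ideal b.
Hypothesis Cb : forall r, b r -> b (C r).

Let bD x y : b x -> b y -> b (x + y).
Proof. by rewrite -{2}[x]mul1r => bx by_; apply: idb.2. Qed.

Let bM x y : b y -> b (x * y).
Proof. by move=> by_; rewrite -[_ * _]addr0; apply: idb.2; case: idb. Qed.

Let iter_stable i r : b r -> b (iter i C r).
Proof. by move=> br; elim: i => //= i /Cb. Qed.

Lemma stable_submod_closed : subsemimod_closed (fun m : M => `[< b m >]).
Proof.
split; first split.
- by apply/asboolP; case: idb.
- by move=> x y /asboolP bx /asboolP by_; apply/asboolP/bD.
move=> u m /asboolP bm; apply/asboolP.
rewrite -[u *: m]/(cartier_scale C u (m : R)) /cartier_scale.
elim/big_ind: _ => [|x y bx by_|i _]; first by case: idb.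
  exact: bD.
by apply: iter_stable; rewrite mulrC; apply: bM.
Qed.

Definition stable_submod : submodClosed M :=
  HB.pack (fun m : M => `[< b m >])
    (GRing.isSubSemiModClosed.Build sk^c M (fun m : M => `[< b m >]) stable_submod_closed).

(** The second hypothesis says that b is maximal.  If r is a coefficient of x^i
    in an annihilating element and r is not in b, write 1 = x + y r with x in b:
    then 1 = C^i 1 = C^i x + C^i (y r) lies in b. *)
Lemma gr_ann_stable : ~ b 1 ->
  (forall r, ~ b r -> exists x y, b x /\ x + y * r = 1) ->
  gr_ann (quotmod stable_submod) = graded_extension b.
Proof.
move=> bN1 b_max; apply/seteqP; split=> u.
  move=> /gr_ann_quotmod uN i; apply: contrapT => bNu.
  have [x [y [bx xy1]]] := b_max _ bNu.
  apply: bN1; rewrite -(iter_cartier1 C1 i) -xy1 iter_cartierD //.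
  apply: bD; first exact: iter_stable.
  by have /asboolP := uN i (y : R); rewrite ract_cartier.
move=> ub; apply/gr_ann_quotmod => i m; apply/asboolP; rewrite ract_cartier.
by apply: iter_stable; apply: bM; apply: ub.
Qed.

End StableIdeal.

End CartierSpecialIdeals.

(** Stated with a map g from R so as to apply both to the regular module and to
    the restriction of scalars of the right module, which share their elements
    but not their module structure. *)
Lemma cyclic_noetherian (R : comNzRingType) (V : lmodType R) (g : R -> V) :
  (forall a x y, g (a * x + y) = a *: g x + g y) ->
  (forall v, exists r, g r = v) ->
  (forall I : nat -> set R, (forall i, is_ideal (I i)) ->
    (forall i, I i `<=` I i.+1) ->
    exists k, forall i, (k <= i)%N -> I i `<=` I k) ->
  noetherian_module V.
Proof.
move=> g_lin g_surj accR N Nsub.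
have g0 : g 0 = 0.
  by have := g_lin (-1) 0 0; rewrite mulr0 addr0 scaleN1r addNr.
have Nle i j : (i <= j)%N -> {subset N i <= N j}.
  by move=> /subnK <-; elim: (j - i)%N => // d IHd v /IHd; apply: Nsub.
have [|i r|k kP] := accR (fun i => [set r | g r \in N i]); last first.
- exists k => i ki v; apply/idP/idP => [|/(Nle _ _ ki)//].
  by have [r <-] := g_surj v; apply: (kP i ki r).
- exact: Nsub.
move=> i; split=> [|a x y /= Nx Ny]; first by rewrite /= g0 rpred0.
by rewrite g_lin rpredD // rpredZ.
Qed.

(** * The theorem *)

Lemma infinite_range (T : Type) (f : nat -> T) (B : set T) : injective f ->
  (forall i, B (f i)) -> infinite_set B.
Proof.
move=> f_inj Bf finB; apply: infinite_nat.
apply: (sub_finite_set _ (finite_preimage (f := f) _ finB)).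
  by move=> i _; apply: Bf.
by move=> i j _ _ /f_inj.
Qed.

Lemma theta_comaximal_primes (K : fieldType) : comaximal_primes (theta K).
Proof.
split.
- exact: polyInf_domain.
- exact: theta_neq0.
- exact: theta_prime.
- exact: theta_compl1.
- exact: theta_complD.
- exact: theta_factor.
Qed.

Theorem mainTheorem2 (K : fieldType) (p : nat) (charK : p \in [pchar K])
    (perfK : perfect_field K p)
    (R : comNzRingType) (phi : {rmorphism polyInf K -> R})
    (locR : is_localization (@theta_compl K) phi) :
  noetherian_ring R /\
  has_krull_dim R 1 /\
  exists str : right_structure (pchar_polyInf_rmorph phi charK),
    let M := right_module_of str in
    [/\ extends_regular str,
        x_divisible M,
        forall i, special_prime_ideals M
          (loc_ideal (@theta_compl K) phi (principal_ideal (theta K i))),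
        infinite_set (special_prime_ideals M) &
        noetherian_module (restr_scal M) /\ infinite_set (gr_ann_images M)].
Proof.
have cop := theta_comaximal_primes K.
have charR := pchar_polyInf_rmorph phi charK.
have T_neq0 := loc_neq0 cop locR; have T_comax := loc_comax cop locR.
have T_factor := loc_factor cop locR; have T_Spec := loc_Spec cop locR.
have accR := ideal_acc T_comax T_factor.
have [C [CD CM C1 Cid]] := cartier_map cop locR charR (pth_power_partD p)
  (pth_power_part_semilinear charK) (pth_power_part1 K p)
  (pth_power_partP charK perfK) (@pth_power_part_theta K p).
split; first by apply: (@cyclic_noetherian R R^o id) => // v; exists v.
split; first exact: (krull_dim_prime_products (loc_domain cop locR) T_neq0).
exists (cartier_structure (pchar_polyInf_rmorph phi charK) CD CM) => M.
pose I i := loc_ideal (@theta_compl K) phi (principal_ideal (theta K i)).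
have IE i : I i = principal_ideal (phi (theta K i)) := loc_idealE locR i.
have gr_annI i : graded_extension (I i) = gr_ann
    (quotmod (stable_submod (pchar_polyInf_rmorph phi charK) CD CM
       (is_ideal_principal (phi (theta K i))) (Cid i))).
  rewrite IE gr_ann_stable => //; first by case: (T_Spec i).
  move=> r /(comax_notin T_comax T_factor)[x [y xy1]].
  by exists (x * phi (theta K i)), y; split=> //; exists x.
have I_inj : injective I.
  move=> i j IIj; apply/eqP; apply: contrapT => /negP ij.
  apply: (loc_notin_neq cop locR ij); rewrite -IE IIj IE.
  by exists 1; rewrite mul1r.
have spI i : special_prime_ideals M (I i).
  split; last by rewrite IE.
  split; first by rewrite IE; apply: is_ideal_principal.
  by eexists; apply: gr_annI.
split=> //.
- exact: cartier_extends.
- exact: cartier_x_divisible.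
- by apply: (infinite_range I_inj) => i; apply: spI.
split.
  apply: (@cyclic_noetherian R (restr_scal M) id) => // [a x y|v]; last by exists v.
  congr (_ + _); rewrite mulrC; apply: esym.
  exact: (cartier_extends (pchar_polyInf_rmorph phi charK) CD CM).
apply: (infinite_range (f := fun i => graded_extension (I i))) => [i j IIj|i].
  by apply/I_inj/(graded_extension_inj IIj); rewrite IE; apply: is_ideal_principal.
by rewrite gr_annI; apply: gr_ann_images_quotmod.
Qed.
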